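(* For all information structures $u,v\in\mathcal{U}$, $$\sup_{g\in\mathcal{G}}\bigl(\mathrm{val}(v,g)-\mathrm{val}(u,g)\bigr)=\inf_{u'\preceq u,\ v'\succeq v}\|u'-v'\|,$$ where the infimum is over $u',v'\in\mathcal{U}$ with $u'\preceq u$ and $v'\succeq v$.
   Context: $K$ is a finite set with $|K|\ge 2$ and $\mathbb{N}=\{0,1,2,\dots\}$. An information structure is an element $u$ of $\mathcal{U}=\Delta(K\times\mathbb{N}\times\mathbb{N})$; in $(k,c,d)$, $k$ is the state, $c$ the signal of player 1, $d$ the signal of player 2. A payoff function is a map $g:K\times I\times J\to[-1,1]$ with $I,J$ nonempty finite sets; $\mathcal{G}$ is the set of all payoff functions. In the zero-sum Bayesian game $\Gamma(u,g)$, $(k,c,d)$ is drawn from $u$, player 1 learns $c$, player 2 learns $d$, they simultaneously choose $i\in I$ and $j\in J$, and player 1 (the maximizer) receives $g(k,i,j)$ from player 2; $\mathrm{val}(u,g)$ is its value in mixed strategies. Player 1 prefers $u$ to $v$, written $u\succeq v$ (equivalently $v\preceq u$), if $\mathrm{val}(u,g)\ge\mathrm{val}(v,g)$ for all $g\in\mathcal{G}$. The total variation norm is $\|u-v\|=\sum_{k,c,d}|u(k,c,d)-v(k,c,d)|$. *)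

(* Defs.v *)
From HB Require Import structures.
From mathcomp Require Import all_boot all_order all_algebra.
From mathcomp Require Import all_classical all_reals all_analysis.

Set Implicit Arguments.
Unset Strict Implicit.
Unset Printing Implicit Defensive.
Import Order.TTheory GRing.Theory Num.Theory.

Local Open Scope classical_set_scope.
Local Open Scope ring_scope.

(* Throughout, x : K * nat * nat is a triple (k, c, d): the
   state x.1.1, the signal x.1.2 of player 1 and the signal x.2 of player 2. *)

Record info_structure (R : realType) (K : finType) := InfoStructure {
  info_mass :> K * nat * nat -> R;
  info_mass_ge0 : forall x, 0 <= info_mass x;
  info_mass_sum1 : (\esum_(x in [set: K * nat * nat]) (info_mass x)%:E = 1)%E
}.

Record payoff_function (R : realType) (K : finType) := PayoffFunction {
  act1 : finType;
  act2 : finType;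
  payoff :> K -> act1 -> act2 -> R;
  act1_nonempty : (0 < #|act1|)%N;
  act2_nonempty : (0 < #|act2|)%N;
  payoff_bounded : forall k i j, -1 <= payoff k i j <= 1
}.

(* \esum is meant for nonnegative families; an absolutely summable real family
   is summed by splitting it into its positive and negative parts. *)
Definition signed_sum (R : realType) (T : choiceType) (f : T -> R) : R :=
  fine (\esum_(x in [set: T]) ((EFin \o f)^\+ x)%E)
  - fine (\esum_(x in [set: T]) ((EFin \o f)^\- x)%E).

(* A mixed strategy plays, after each signal n, a mixed action s n on A. *)
Definition strategies (R : realType) (A : finType) : set (nat -> A -> R) :=
  [set s : nat -> A -> R | forall n, (forall a, 0 <= s n a) /\ \sum_a s n a = 1].
Arguments strategies : clear implicits.

Definition expected_payoff (R : realType) (K : finType)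
    (u : info_structure R K) (g : payoff_function R K)
    (s : nat -> act1 g -> R) (t : nat -> act2 g -> R) : R :=
  signed_sum (fun x : K * nat * nat =>
    u x * \sum_i \sum_j s x.1.2 i * t x.2 j * g x.1.1 i j).
Arguments expected_payoff {R K} u g s t.

Definition maxmin (R : realType) (K : finType)
    (u : info_structure R K) (g : payoff_function R K) : R :=
  sup [set inf [set expected_payoff u g s t | t in strategies R (act2 g)]
      | s in strategies R (act1 g)].

Definition minmax (R : realType) (K : finType)
    (u : info_structure R K) (g : payoff_function R K) : R :=
  inf [set sup [set expected_payoff u g s t | s in strategies R (act1 g)]
      | t in strategies R (act2 g)].

(* The value is the common value of maxmin and minmax. These always coincide,
   by the minimax theorem (the strategy sets are compact and convex), so the
   default 0 of xget is never used. *)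
Definition is_value (R : realType) (K : finType)
    (u : info_structure R K) (g : payoff_function R K) (w : R) : Prop :=
  maxmin u g = w /\ minmax u g = w.

Definition value (R : realType) (K : finType)
    (u : info_structure R K) (g : payoff_function R K) : R :=
  xget 0 [set w | is_value u g w].

Definition prefers (R : realType) (K : finType)
    (u v : info_structure R K) : Prop :=
  forall g : payoff_function R K, value v g <= value u g.

Definition tv_dist (R : realType) (K : finType)
    (u v : info_structure R K) : R :=
  fine (\esum_(x in [set: K * nat * nat]) (`|u x - v x|%R)%:E)%E.

(* Main.v *)
Require Import Defs.
From HB Require Import structures.
From mathcomp Require Import all_boot all_order all_algebra.
From mathcomp Require Import all_classical all_reals all_analysis.
From mathcomp Require Import ring lra.

(** One inequality is soft: the value is monotone along [prefers] and
    1-Lipschitz for the total variation norm, so every gap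
    [value v g - value u g] is at most every distance [tv_dist u' v'].

    For the other one, let W bound all the gaps. Garbling the signal of player 1
    in u can only hurt player 1, and garbling the signal of player 2 in v can
    only help player 1, so it is enough to find garblings u' of u and v' of v
    whose distance is at most W + e ([exists_close_garblings]). The distance is
    the supremum over sign functions g of E_v'[g] - E_u'[g]. Read g as a payoff
    function whose actions are the signals: then E_v'[g] is the payoff in v when
    player 1 announces her signal truthfully and player 2 announces the garbled
    one, and E_u'[g] is the payoff in u when it is player 1 who garbles. For a
    fixed g, optimal garblings make the difference at most
    value v g - value u g <= W. Exchanging the choice of g with that of the
    garblings is a minimax argument, in which a mixture of sign functions is a
    payoff function with values in [-1, 1].

    Every minimax step rests on Blackwell's approachability argument
    ([approachable]): if each mixture of finitely many bounded convex losses
    can be made nonpositive, then all the losses can be made at most e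
    simultaneously. Only one side has to be finite, so no compactness of the
    set of strategies is needed. The same lemma shows that maxmin and minmax
    agree, hence that [value] is the value of the game ([guarantee_value1] and
    [guarantee_value2]). Signals range over nat; finiteness comes from the fact
    that all but e of the mass lies on finitely many signals
    ([expect_truncate]). *)

Set Implicit Arguments.
Unset Strict Implicit.
Unset Printing Implicit Defensive.
Import Order.TTheory GRing.Theory Num.Theory.

Local Open Scope classical_set_scope.
Local Open Scope ring_scope.

(** * Signed sums of absolutely summable families *)

Section SignedSum.
Context {R : realType} {T : choiceType}.
Implicit Types a b f g : T -> R.

Definition abs_summable f := summable [set: T] (EFin \o f).

Lemma le_abs_summable f g :
  (forall x, `|f x| <= g x) -> abs_summable g -> abs_summable f.
Proof.
move=> fg; apply: le_lt_trans; apply: le_esum => x _ /=.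
by rewrite lee_fin (le_trans (fg x)) ?ler_norm.
Qed.

Lemma abs_summableD f g :
  abs_summable f -> abs_summable g -> abs_summable (fun x => f x + g x).
Proof. exact: summableD. Qed.

Lemma abs_summableN f : abs_summable f -> abs_summable (fun x => - f x).
Proof. by apply: le_lt_trans; apply: le_esum => x _ /=; rewrite normrN. Qed.

Lemma abs_summableB f g :
  abs_summable f -> abs_summable g -> abs_summable (fun x => f x - g x).
Proof. by move=> sf sg; apply: abs_summableD => //; exact: abs_summableN. Qed.

Lemma abs_summable_norm f : abs_summable f -> abs_summable (fun x => `|f x|).
Proof. by apply: le_lt_trans; apply: le_esum => x _ /=; rewrite normr_id. Qed.

Lemma esum_fin_num a : (forall x, 0 <= a x) -> abs_summable a ->
  (\esum_(x in [set: T]) (a x)%:E)%E \is a fin_num.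
Proof.
move=> a0; rewrite /abs_summable summableE.
by under eq_esum do rewrite /= ger0_norm//.
Qed.

(** Any decomposition as a difference of nonnegative summable families computes
    the signed sum, not only the one into positive and negative parts; the
    algebra of signed sums below follows from this freedom. *)
Lemma signed_sum_diff a b : (forall x, 0 <= a x) -> (forall x, 0 <= b x) ->
  abs_summable a -> abs_summable b ->
  signed_sum (fun x => a x - b x) =
  fine (\esum_(x in [set: T]) (a x)%:E) - fine (\esum_(x in [set: T]) (b x)%:E).
Proof.
move=> a0 b0 sa sb.
have sab := abs_summableB sa sb.
have sp := summable_funepos sab; have sn := summable_funeneg sab.
have finp := esum_fin_num a0 sa; have finn := esum_fin_num b0 sb.
have E : (\esum_(x in setT) ((EFin \o (fun x => (a x - b x)%R))^\+ x)
    - \esum_(x in setT) ((EFin \o (fun x => (a x - b x)%R))^\- x)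
    = \esum_(x in setT) (a x)%:E - \esum_(x in setT) (b x)%:E)%E.
  by apply: (@esumB R T setT (EFin \o a) (EFin \o b)) => // x _;
    rewrite lee_fin.
rewrite /signed_sum -!fineB// ?E//.
- move: sp; rewrite summableE.
  by under eq_esum do rewrite gee0_abs//.
- move: sn; rewrite summableE.
  by under eq_esum do rewrite gee0_abs//.
Qed.

Lemma abs_summable0 : abs_summable (fun=> 0).
Proof.
by rewrite /abs_summable /summable esum1// => x _ /=; rewrite normr0.
Qed.

Lemma signed_sum_ge0E a : (forall x, 0 <= a x) -> abs_summable a ->
  signed_sum a = fine (\esum_(x in [set: T]) (a x)%:E).
Proof.
move=> a0 sa; transitivity (signed_sum (fun x => a x - 0)).
  by congr signed_sum; apply/funext => x; rewrite subr0.
rewrite signed_sum_diff//; last exact: abs_summable0.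
by rewrite [X in _ - fine X]esum1// subr0.
Qed.

Lemma eq_signed_sum f g : f =1 g -> signed_sum f = signed_sum g.
Proof. by move=> /funext ->. Qed.

(* Used with f = |f| - negp f, a difference of nonnegative families whose
   parts need no case distinction on the sign of f. *)
Let negp f x : R := `|f x| - f x.

Let negp_ge0 f x : 0 <= negp f x. Proof. by rewrite subr_ge0 ler_norm. Qed.

Let abs_summable_negp f : abs_summable f -> abs_summable (negp f).
Proof. by move=> sf; apply: abs_summableB => //; exact: abs_summable_norm. Qed.

Let signed_sum_negp f : abs_summable f ->
  signed_sum f = fine (\esum_(x in [set: T]) `|f x|%:E)
               - fine (\esum_(x in [set: T]) (negp f x)%:E).
Proof.
move=> sf; rewrite -signed_sum_diff//; first last.
- exact: abs_summable_negp.
- exact: abs_summable_norm.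
- by apply: eq_signed_sum => x; rewrite /negp; ring.
Qed.

Let fine_esumD a b : (forall x, 0 <= a x) -> (forall x, 0 <= b x) ->
  abs_summable a -> abs_summable b ->
  fine (\esum_(x in [set: T]) (a x + b x)%:E) =
  fine (\esum_(x in [set: T]) (a x)%:E) + fine (\esum_(x in [set: T]) (b x)%:E).
Proof.
move=> a0 b0 sa sb; rewrite -fineD ?esum_fin_num// -esumD//.
- by move=> x _; rewrite lee_fin.
- by move=> x _; rewrite lee_fin.
Qed.

Lemma signed_sumB f g : abs_summable f -> abs_summable g ->
  signed_sum (fun x => f x - g x) = signed_sum f - signed_sum g.
Proof.
move=> sf sg.
have [sp sq] := (abs_summable_norm sf, abs_summable_norm sg).
have [sn sm] := (abs_summable_negp sf, abs_summable_negp sg).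
transitivity (signed_sum (fun x => (`|f x| + negp g x) - (negp f x + `|g x|))).
  by apply: eq_signed_sum => x; rewrite /negp; ring.
rewrite signed_sum_diff; first last.
- exact: abs_summableD.
- exact: abs_summableD.
- by move=> x; rewrite addr_ge0.
- by move=> x; rewrite addr_ge0.
rewrite (fine_esumD _ _ sp sm)// (fine_esumD _ _ sn sq)//.
rewrite (signed_sum_negp sf) (signed_sum_negp sg).
by do 4 move: (fine _) => ?; ring.
Qed.

Lemma signed_sum0 : signed_sum (fun _ : T => 0 : R) = 0.
Proof. by rewrite signed_sum_ge0E//; [rewrite esum1|exact: abs_summable0]. Qed.

Lemma signed_sumN f : abs_summable f ->
  signed_sum (fun x => - f x) = - signed_sum f.
Proof.
move=> sf; rewrite -[RHS]add0r -signed_sum0 -signed_sumB ?abs_summable0//.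
by apply: eq_signed_sum => x; rewrite sub0r.
Qed.

Lemma signed_sumD f g : abs_summable f -> abs_summable g ->
  signed_sum (fun x => f x + g x) = signed_sum f + signed_sum g.
Proof.
move=> sf sg; rewrite -[signed_sum g]opprK -signed_sumN// -signed_sumB//.
  by apply: eq_signed_sum => x; rewrite opprK.
exact: abs_summableN.
Qed.

Lemma signed_sum_ge0 a : (forall x, 0 <= a x) -> abs_summable a ->
  0 <= signed_sum a.
Proof.
move=> a0 sa; rewrite signed_sum_ge0E// fine_ge0// esum_ge0// => x _.
by rewrite lee_fin.
Qed.

Lemma le_signed_sum f g : (forall x, f x <= g x) ->
  abs_summable f -> abs_summable g -> signed_sum f <= signed_sum g.
Proof.
move=> fg sf sg; rewrite -subr_ge0 -signed_sumB//.
by apply: signed_sum_ge0; [move=> x; rewrite subr_ge0 | exact: abs_summableB].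
Qed.

Lemma esumZ (r : R) a : 0 <= r -> (forall x, 0 <= a x) ->
  (\esum_(x in [set: T]) (r * a x)%:E =
   r%:E * \esum_(x in [set: T]) (a x)%:E)%E.
Proof.
move=> r0 a0; rewrite /esum -ereal_supZl//; last first.
  by apply/set0P; eexists; exists set0; [exact: fsets_set0|reflexivity].
congr ereal_sup; apply/seteqP; split => y.
- move=> [A fA <-]; exists (\sum_(x \in A) (a x)%:E)%E; first by exists A.
  by rewrite ge0_mule_fsumr// => x; rewrite lee_fin.
- move=> [_ [A fA <-] <-]; exists A => //.
  by rewrite ge0_mule_fsumr// => x; rewrite lee_fin.
Qed.

Lemma abs_summableZ (r : R) f :
  abs_summable f -> abs_summable (fun x => r * f x).
Proof.
move=> sf; rewrite /abs_summable /summable.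
under eq_esum do rewrite /= normrM.
rewrite esumZ// lte_mul_pinfty// ?lee_fin//.
Qed.

Lemma signed_sumZ (r : R) f : abs_summable f ->
  signed_sum (fun x => r * f x) = r * signed_sum f.
Proof.
wlog r0 : r / 0 <= r => [wl sf|].
  have [/wl->//|r0] := leP 0 r.
  rewrite -[r]opprK mulNr -wl ?oppr_ge0 ?(ltW r0)// -signed_sumN.
    by apply: eq_signed_sum => x; rewrite !mulNr.
  exact: abs_summableZ.
move=> sf.
have [sp sn] := (abs_summable_norm sf, abs_summable_negp sf).
transitivity (signed_sum (fun x => r * `|f x| - r * negp f x)).
  by apply: eq_signed_sum => x; rewrite /negp; ring.
rewrite signed_sum_diff; first last.
- exact: abs_summableZ.
- exact: abs_summableZ.
- by move=> x; rewrite mulr_ge0.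
- by move=> x; rewrite mulr_ge0.
rewrite !esumZ// !fineM// ?esum_fin_num//=.
by rewrite (signed_sum_negp sf) mulrBr.
Qed.

Lemma abs_summable_sum (I : Type) (r : seq I) (F : I -> T -> R) :
  (forall i, abs_summable (F i)) -> abs_summable (fun x => \sum_(i <- r) F i x).
Proof.
move=> sF; elim: r => [|i r IH].
  by under eq_fun do rewrite big_nil; exact: abs_summable0.
by under eq_fun do rewrite big_cons; exact: abs_summableD.
Qed.

Lemma signed_sum_sum (I : Type) (r : seq I) (F : I -> T -> R) :
  (forall i, abs_summable (F i)) ->
  signed_sum (fun x => \sum_(i <- r) F i x) = \sum_(i <- r) signed_sum (F i).
Proof.
move=> sF; elim: r => [|i r IH].
  rewrite big_nil -[RHS]signed_sum0; apply: eq_signed_sum => x.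
  by rewrite big_nil.
rewrite big_cons -IH -signed_sumD//; last exact: abs_summable_sum.
by apply: eq_signed_sum => x; rewrite big_cons.
Qed.

End SignedSum.

Lemma esum_swap (R : realType) (T T' : choiceType) (a : T -> T' -> R) :
  (forall x y, 0 <= a x y) ->
  (\esum_(x in [set: T]) \esum_(y in [set: T']) (a x y)%:E =
   \esum_(y in [set: T']) \esum_(x in [set: T]) (a x y)%:E)%E.
Proof.
move=> a0; rewrite !esum_esum; try by move=> *; rewrite lee_fin.
rewrite (reindex_esum ([set: T'] `*`` (fun=> [set: T])) _
  (fun z => (z.2, z.1)))//.
split => //=.
- by move=> [i1 i2] [j1 j2] /= _ _ [-> ->].
- by move=> [i j] _; exists (j, i).
Qed.

Lemma esum_dirac (R : realType) (T : choiceType) (z : T) (a : T -> R) :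
  (forall x, 0 <= a x) ->
  (\esum_(x in [set: T]) (a x * (z == x)%:R)%:E = (a z)%:E)%E.
Proof.
move=> a0; rewrite -[RHS](esum_set1 (a := EFin \o a))/= ?lee_fin//.
rewrite [RHS]esum_mkcond; apply: eq_esum => x _; rewrite in_set1 eq_sym.
by case: eqP => _; rewrite ?mulr1 ?mulr0.
Qed.

(** * Expectations under an information structure *)

Section Expectation.
Context {R : realType} {K : finType}.
Implicit Types (u v : info_structure R K) (h : K * nat * nat -> R) (M : R).

Definition expect u h : R := signed_sum (fun x => u x * h x).

Definition bounded_by M h := forall x, `|h x| <= M.

Lemma info_summable u : abs_summable u.
Proof.
rewrite /abs_summable /summable.
under eq_esum do rewrite /= ger0_norm ?info_mass_ge0//.
by rewrite info_mass_sum1 ltry.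
Qed.

Lemma expect_summable u M h :
  bounded_by M h -> abs_summable (fun x => u x * h x).
Proof.
move=> hM; apply: (@le_abs_summable _ _ _ (fun x => M * u x)).
  move=> x; rewrite normrM ger0_norm ?info_mass_ge0// mulrC.
  by rewrite ler_wpM2r// info_mass_ge0.
exact/abs_summableZ/info_summable.
Qed.

Lemma eq_expect u h h' : h =1 h' -> expect u h = expect u h'.
Proof. by move=> /funext ->. Qed.

Lemma expect_cst u (c : R) : expect u (fun=> c) = c.
Proof.
rewrite /expect (@eq_signed_sum _ _ _ (fun x => c * u x)); last first.
  by move=> x; rewrite mulrC.
rewrite signed_sumZ; last exact: info_summable.
rewrite signed_sum_ge0E; [|exact: info_mass_ge0|exact: info_summable].
by rewrite info_mass_sum1 mulr1.
Qed.

Lemma le_expect u M h h' : bounded_by M h -> bounded_by M h' ->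
  (forall x, h x <= h' x) -> expect u h <= expect u h'.
Proof.
move=> hM h'M hh'; apply: le_signed_sum; try exact: expect_summable.
by move=> x; rewrite ler_wpM2l// info_mass_ge0.
Qed.

Lemma bounded_by_norm M h : bounded_by M h -> bounded_by `|M| h.
Proof. by move=> hM x; rewrite (le_trans (hM x))// ler_norm. Qed.

Lemma expect_bounded u M h : 0 <= M -> bounded_by M h -> `|expect u h| <= M.
Proof.
move=> M0 hM; rewrite ler_norml -{1}(expect_cst u (- M)) -{2}(expect_cst u M).
have cM : bounded_by M (fun=> M) by move=> x; rewrite ger0_norm.
have cNM : bounded_by M (fun=> - M) by move=> x; rewrite normrN ger0_norm.
apply/andP; split; apply: (@le_expect _ M) => // x;
  by move: (hM x); rewrite ler_norml => /andP[].
Qed.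

Lemma expectD u M h h' : bounded_by M h -> bounded_by M h' ->
  expect u (fun x => h x + h' x) = expect u h + expect u h'.
Proof.
move=> hM h'M; rewrite -signed_sumD; try exact: expect_summable.
by apply: eq_signed_sum => x; rewrite mulrDr.
Qed.

Lemma expect_sum u M (I : Type) (r : seq I) (p : I -> R)
    (F : I -> K * nat * nat -> R) : (forall i, bounded_by M (F i)) ->
  expect u (fun x => \sum_(i <- r) p i * F i x) =
  \sum_(i <- r) p i * expect u (F i).
Proof.
move=> FM; transitivity
    (signed_sum (fun x => \sum_(i <- r) p i * (u x * F i x))).
  apply: eq_signed_sum => x; rewrite mulr_sumr.
  by apply: eq_bigr => i _; rewrite mulrCA.
rewrite signed_sum_sum; last by move=> i; apply/abs_summableZ/expect_summable.
by apply: eq_bigr => i _; rewrite signed_sumZ//; exact: expect_summable.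
Qed.

Let summable_diff u v : abs_summable (fun x => u x - v x).
Proof. by apply: abs_summableB; exact: info_summable. Qed.

Let tv_distE u v : tv_dist u v = signed_sum (fun x => `|u x - v x|).
Proof.
by rewrite signed_sum_ge0E//; exact/abs_summable_norm/summable_diff.
Qed.

Lemma expect_tv_dist u v h : bounded_by 1 h ->
  expect u h - expect v h <= tv_dist u v.
Proof.
move=> h1; rewrite tv_distE -signed_sumB; try exact: expect_summable.
apply: le_signed_sum; last 2 first.
- by apply: abs_summableB; exact: expect_summable.
- exact/abs_summable_norm/summable_diff.
move=> x; rewrite -mulrBl (le_trans (ler_norm _))// normrM.
by rewrite ler_piMr.
Qed.

(** The test function that witnesses the distance between u and v: total
    variation is dual to the sup norm. *)
Definition sign_diff u v x : R := if v x <= u x then 1 else -1.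

Lemma tv_dist_sign u v :
  tv_dist u v = expect u (sign_diff u v) - expect v (sign_diff u v).
Proof.
have b1 : bounded_by 1 (sign_diff u v).
  by move=> x; rewrite /sign_diff; case: ifP => _; rewrite ?normrN normr1.
rewrite tv_distE -signed_sumB; try exact: expect_summable.
apply: eq_signed_sum => x; rewrite /sign_diff; case: ifPn => [vu|].
  by rewrite ger0_norm ?subr_ge0//; ring.
by rewrite -ltNge => uv; rewrite ltr0_norm ?subr_lt0//; ring.
Qed.

(** All but e / 2 of the mass lies on finitely many triples, and on the rest two
    functions with values in [-1, 1] differ by at most 2. The inequality is
    one-sided because h and h' play symmetric roles. *)
Lemma expect_truncate u (e : R) : 0 < e ->
  exists n : nat, forall h h', bounded_by 1 h -> bounded_by 1 h' ->
    (forall x, (x.1.2 < n)%N -> (x.2 < n)%N -> h x = h' x) ->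
    expect u h <= expect u h' + e.
Proof.
move=> e0; have e20 : 0 < e / 2 by rewrite divr_gt0.
have : ((1 - e / 2)%:E < \esum_(x in [set: K * nat * nat]) (u x)%:E)%E.
  by rewrite info_mass_sum1 lte_fin; lra.
move=> /ereal_sup_gt[_ [A [finA _] <-] ltA].
have /finite_seqP[s As] := finA.
pose n := (\max_(x <- s) maxn x.1.2 x.2).+1.
have An x : A x -> ((x.1.2 < n) && (x.2 < n))%N.
  rewrite As /= => xs; rewrite /n !ltnS -geq_max.
  exact: (@leq_bigmax_seq _ s xpredT (fun x => maxn x.1.2 x.2)).
exists n => h h' h1 h'1 hh'.
pose iA x : R := (x \in A)%:R.
have iA01 x : 0 <= iA x <= 1.
  by rewrite /iA; case: (_ \in _); rewrite ?lexx ?ler01.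
have iA1 : bounded_by 1 iA.
  by move=> x; have /andP[i0 i1] := iA01 x; rewrite ger0_norm.
have massA : expect u iA > 1 - e / 2.
  rewrite -lte_fin; apply: lt_le_trans ltA _.
  rewrite /expect signed_sum_ge0E; last 2 first.
  - by move=> x; rewrite mulr_ge0 ?info_mass_ge0.
  - exact: expect_summable.
  rewrite fineK; last first.
    apply: esum_fin_num; last exact: expect_summable.
    by move=> x; rewrite mulr_ge0 ?info_mass_ge0.
  rewrite -esum_fset//; last by move=> x _; rewrite lee_fin info_mass_ge0.
  rewrite esum_mkcond; apply: le_esum => x _; rewrite /iA.
  by case: (x \in A); rewrite ?mulr1 ?mulr0.
(* b bounds h - h' and has small expectation. *)
pose b x := 2 * 1 + (-2) * iA x.
have hb : expect u b = 2 - 2 * expect u iA.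
  have -> : expect u b = expect u (fun x => \sum_(i <- [:: true; false])
       (if i then 2 else -2) * (if i then (fun=> 1) else iA) x).
    by apply: eq_expect => x; rewrite !big_cons big_nil addr0.
  rewrite (@expect_sum _ 1); last by case => // x; rewrite normr1.
  by rewrite !big_cons big_nil /= expect_cst; ring.
have bM : bounded_by 3 b.
  move=> x; rewrite /b ler_norml; move: (iA01 x) => /andP[? ?].
  by apply/andP; split; lra.
have h'3 : bounded_by 3 h' by move=> x; apply: le_trans (h'1 x) _; lra.
have : expect u h <= expect u (fun x => h' x + b x).
  apply: (@le_expect _ 6).
  - by move=> x; apply: le_trans (h1 x) _; lra.
  - move=> x; rewrite (le_trans (ler_normD _ _))//.
    by move: (h'3 x) (bM x); lra.
  move=> x; rewrite /b /iA; case: (boolP (x \in A)) => [|_] /=.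
    by rewrite inE => /An/andP[xn1 xn2]; rewrite hh'//; lra.
  by move: (h1 x) (h'1 x); rewrite !ler_norml => /andP[_ ?] /andP[? _]; lra.
rewrite (expectD _ h'3 bM) hb.
by move: (expect u iA) massA (expect u h) (expect u h') => *; lra.
Qed.

End Expectation.

(** * Image of an information structure under a kernel *)

(* The kernel moves x to m x b with probability p x b. Finitely many branches b
   suffice for garblings and keep the inner sums finite. *)
Section Push.
Context {R : realType} {K F : finType} (u : info_structure R K).
Variables (p : K * nat * nat -> F -> R).
Variables (m : K * nat * nat -> F -> K * nat * nat).
Hypothesis p_ge0 : forall x b, 0 <= p x b.
Hypothesis p_sum1 : forall x, \sum_b p x b = 1.

Definition push_mass y : R :=
  expect u (fun x => \sum_b p x b * (m x b == y)%:R).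

Lemma weighted_sum_bounded M (a : K * nat * nat -> F -> R) :
  (forall x b, `|a x b| <= M) -> bounded_by M (fun x => \sum_b p x b * a x b).
Proof.
move=> aM x; rewrite (le_trans (ler_norm_sum _ _ _))//.
rewrite -[leRHS]mul1r -(p_sum1 x) mulr_suml; apply: ler_sum => b _.
by rewrite normrM ger0_norm// ler_wpM2l.
Qed.

Let hit_bounded y : bounded_by 1 (fun x => \sum_b p x b * (m x b == y)%:R : R).
Proof.
by apply: weighted_sum_bounded => x b; case: eqP => _; rewrite ?normr1 ?normr0.
Qed.

Let hit_ge0 x y : 0 <= u x * \sum_b p x b * (m x b == y)%:R.
Proof.
rewrite mulr_ge0 ?info_mass_ge0// sumr_ge0// => b _.
by rewrite mulr_ge0.
Qed.

Lemma push_mass_ge0 y : 0 <= push_mass y.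
Proof. by apply: signed_sum_ge0 => //; apply/expect_summable/hit_bounded. Qed.

(** Exchange of the order of summation; h is nonnegative so that Fubini holds
    in the extended reals. *)
Lemma esum_push M h : bounded_by M h -> (forall y, 0 <= h y) ->
  (\esum_(y in [set: K * nat * nat]) (push_mass y * h y)%:E =
  (expect u (fun x => \sum_b p x b * h (m x b)))%:E)%E.
Proof.
move=> hM h0.
have sumh : bounded_by M (fun x => \sum_b p x b * h (m x b)).
  by apply: weighted_sum_bounded.
have uh0 x : 0 <= u x * \sum_b p x b * h (m x b).
  by rewrite mulr_ge0 ?info_mass_ge0// sumr_ge0// => b _; rewrite mulr_ge0.
transitivity (\esum_(y in [set: K * nat * nat])
    \esum_(x in [set: K * nat * nat])
      (h y * (u x * \sum_b p x b * (m x b == y)%:R))%:E)%E.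
  apply: eq_esum => y _; rewrite esumZ// mulrC EFinM; congr (_ * _)%E.
  have sum_hit := expect_summable u (hit_bounded y).
  rewrite /push_mass /expect signed_sum_ge0E//.
  by rewrite fineK//; exact: esum_fin_num.
rewrite esum_swap; last by move=> *; rewrite mulr_ge0.
have sum_uh := expect_summable u sumh.
rewrite /expect signed_sum_ge0E// fineK; last exact: esum_fin_num.
apply: eq_esum => x _.
transitivity (\esum_(y in [set: K * nat * nat])
    \sum_(b <- index_enum F) ((u x * p x b * h y) * (m x b == y)%:R)%:E)%E.
  apply: eq_esum => y _; rewrite sumEFin !mulr_sumr; congr EFin.
  by apply: eq_bigr => b _; ring.
rewrite esum_sum; last first.
  by move=> y b _ _; rewrite lee_fin !mulr_ge0// info_mass_ge0.
rewrite mulr_sumr -sumEFin; apply: eq_bigr => b _.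
by rewrite esum_dirac ?mulrA// => y; rewrite !mulr_ge0// info_mass_ge0.
Qed.

Lemma push_mass_sum1 :
  (\esum_(y in [set: K * nat * nat]) (push_mass y)%:E = 1)%E.
Proof.
transitivity (\esum_(y in [set: K * nat * nat]) (push_mass y * 1)%:E)%E.
  by apply: eq_esum => y _; rewrite mulr1.
rewrite (@esum_push 1) => // [|x]; last by rewrite normr1.
rewrite (@eq_expect _ _ _ _ (fun=> 1)) ?expect_cst// => x.
by under eq_bigr do rewrite mulr1.
Qed.

Definition push : info_structure R K :=
  InfoStructure push_mass_ge0 push_mass_sum1.

(** The change of variables for bounded h of any sign: h + M is nonnegative and
    constants are preserved. *)
Lemma expect_push M h : bounded_by M h ->
  expect push h = expect u (fun x => \sum_b p x b * h (m x b)).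
Proof.
move=> hM.
have cM : bounded_by `|M| (fun _ : K * nat * nat => M) by [].
have h'M := bounded_by_norm hM.
have hM' : bounded_by (`|M| + `|M|) (fun x => h x + M).
  by move=> x; rewrite (le_trans (ler_normD _ _))// lerD.
have h0 x : 0 <= h x + M.
  by move: (hM x); rewrite ler_norml => /andP[? _]; rewrite -lerBlDr sub0r.
have sM : bounded_by `|M| (fun x => \sum_b p x b * h (m x b)).
  exact: weighted_sum_bounded.
apply: (addIr M); rewrite -{1}(expect_cst push M) -(expectD _ h'M cM).
rewrite -[in RHS](expect_cst u M) -(expectD _ sM cM).
rewrite {1}/expect signed_sum_ge0E; last 2 first.
- by move=> x; rewrite mulr_ge0// push_mass_ge0.
- exact: expect_summable hM'.
rewrite (esum_push hM' h0) /=; apply: eq_expect => x.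
rewrite -[M in RHS]mul1r -(p_sum1 x) mulr_suml -big_split.
by apply: eq_bigr => b _; rewrite mulrDr.
Qed.

End Push.

(** * Approachability *)

(* The losses f i y are controlled by the choice of y in an arbitrary type with
   convex combinations; only the index set of the losses is finite. *)
Section Approachability.
Context {R : realType} {I : finType} {Y : Type}.
Variables (f : I -> Y -> R) (M : R) (y0 : Y).
Hypothesis f_bounded : forall i y, `|f i y| <= M.
Hypothesis f_convex : forall (r : R) y z, 0 <= r <= 1 ->
  exists w, forall i, f i w <= (1 - r) * f i y + r * f i z.

Let pospart i y : R := Num.max 0 (f i y).
Let excess y : R := \sum_i pospart i y ^+ 2.

Let pospart_ge0 i y : 0 <= pospart i y.
Proof. by rewrite /pospart le_max lexx. Qed.

Let pospart_sqr_le i y (c : R) : f i y <= c -> pospart i y ^+ 2 <= c ^+ 2.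
Proof.
move=> fc; rewrite /pospart; case: (leP 0 (f i y)) => f0.
  by rewrite lerXn2r// nnegrE (le_trans f0).
by rewrite expr0n sqr_ge0.
Qed.

Let M2_ge0 : 0 <= \sum_(i : I) M ^+ 2.
Proof. by apply: sumr_ge0 => i _; exact: sqr_ge0. Qed.

Let norm_sqr_le i y : f i y ^+ 2 <= M ^+ 2.
Proof.
rewrite -[f i y ^+ 2]real_normK ?num_real// lerXn2r ?nnegrE//.
exact: le_trans (f_bounded i y).
Qed.

Hypothesis f_mixed_le0 : forall p : I -> R, (forall i, 0 <= p i) ->
  \sum_i p i = 1 -> exists y, \sum_i p i * f i y <= 0.

(* At y, weight each loss by its positive part. *)
Let response y : exists z, \sum_i pospart i y * f i z <= 0.
Proof.
pose S := \sum_i pospart i y.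
have S0 : 0 <= S by apply: sumr_ge0.
have [S_eq0|S_neq0] := eqVneq S 0.
  exists y; rewrite big1// => i _.
  by rewrite (psumr_eq0P (fun i _ => pospart_ge0 i y) S_eq0)// mul0r.
have [||z fz] := @f_mixed_le0 (fun i => pospart i y / S).
- by move=> i; rewrite divr_ge0.
- by rewrite -mulr_suml divff.
exists z; have Sgt0 : 0 < S by rewrite lt0r S_neq0.
rewrite -(pmulr_rle0 _ (_ : 0 < S^-1)) ?invr_gt0// mulr_sumr.
by under eq_bigr do rewrite mulrA [S^-1 * _]mulrC.
Qed.

(* A step of size 1 / (n + 2) from y towards a response z adds to the excess a
   nonpositive cross term and a square of order 1 / (n + 2) ^ 2; with this step
   size the bound B / (n + 1) becomes exactly B / (n + 2). *)
Let excess_small (n : nat) :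
  exists y, excess y <= (\sum_(i : I) M ^+ 2) / n.+1%:R.
Proof.
elim: n => [|n [y IH]].
  exists y0; rewrite divr1; apply: ler_sum => i _.
  by apply: pospart_sqr_le; rewrite (le_trans (ler_norm _)).
have [z az] := response y.
pose r : R := n.+2%:R^-1.
have r01 : 0 <= r <= 1 by rewrite invr_ge0 ler0n invf_le1 ?ltr0n// ler1n.
have [w fw] := f_convex y z r01; exists w.
set B := \sum_(i : I) M ^+ 2 in IH *.
have : excess w <= \sum_i ((1 - r) ^+ 2 * pospart i y ^+ 2
    + 2 * r * (1 - r) * (pospart i y * f i z) + r ^+ 2 * f i z ^+ 2).
  apply: ler_sum => i _.
  apply: (@le_trans _ _ (((1 - r) * pospart i y + r * f i z) ^+ 2)).
    apply: pospart_sqr_le; apply: (le_trans (fw i)); rewrite lerD2r.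
    case/andP: r01 => _ r1; rewrite ler_wpM2l ?subr_ge0//.
    by rewrite /pospart le_max lexx orbT.
  by rewrite le_eqVlt; apply/orP; left; apply/eqP; ring.
rewrite !big_split /= -!mulr_sumr -/(excess y) => le_w.
have Bz : \sum_i f i z ^+ 2 <= B by apply: ler_sum => i _; exact: norm_sqr_le.
apply: (le_trans le_w); case/andP: r01 => r0 r1.
have r1' : 0 <= 1 - r by rewrite subr_ge0.
have cross : 2 * r * (1 - r) * (\sum_i pospart i y * f i z) <= 0.
  by rewrite mulr_ge0_le0// !mulr_ge0.
have head : (1 - r) ^+ 2 * excess y <= (1 - r) ^+ 2 * (B / n.+1%:R).
  by rewrite ler_wpM2l// sqr_ge0.
have tail : r ^+ 2 * (\sum_i f i z ^+ 2) <= r ^+ 2 * B.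
  by rewrite ler_wpM2l// sqr_ge0.
have -> : B / n.+2%:R = (1 - r) ^+ 2 * (B / n.+1%:R) + 0 + r ^+ 2 * B.
  rewrite /r -![_.+1%:R]natr1; have n0 : (0 : R) <= n%:R by [].
  by field; apply/andP; split; lra.
by rewrite !lerD.
Qed.

(** The squared distance from the vector of losses to the nonpositive orthant
    can be made arbitrarily small. *)
Lemma approachable (e : R) : 0 < e -> exists y, forall i, f i y <= e.
Proof.
move=> e0; pose B := \sum_(i : I) M ^+ 2.
have [n Bn] : exists n, B / n.+1%:R <= e ^+ 2.
  exists (Num.truncn (B / e ^+ 2)); rewrite ler_pdivrMr ?ltr0n//.
  rewrite mulrC -ler_pdivrMr ?exprn_gt0// ltW//.
  by have /andP[] := truncn_itv (divr_ge0 M2_ge0 (sqr_ge0 e)).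
have [y ey] := excess_small n; exists y => i.
have : pospart i y ^+ 2 <= e ^+ 2.
  apply: le_trans Bn; apply: le_trans ey.
  by rewrite /excess (bigD1 i)//= lerDl sumr_ge0// => j _; exact: sqr_ge0.
rewrite ler_pXn2r ?nnegrE ?(ltW e0)//.
by rewrite /pospart ge_max => /andP[].
Qed.

End Approachability.

(** * Mixed strategies and their payoffs *)

Section MixedPayoff.
Context {R : realType} {K A B : finType}.
Implicit Types (g : K -> A -> B -> R) (s : nat -> A -> R) (t : nat -> B -> R).

Definition mixed_payoff g s t (x : K * nat * nat) : R :=
  \sum_i \sum_j s x.1.2 i * t x.2 j * g x.1.1 i j.

Lemma mixed_payoff_bounded g s t : (forall k i j, -1 <= g k i j <= 1) ->
  strategies R A s -> strategies R B t -> bounded_by 1 (mixed_payoff g s t).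
Proof.
move=> g1 hs ht x; have [[s0 s1] [t0 t1]] := (hs x.1.2, ht x.2).
rewrite (le_trans (ler_norm_sum _ _ _))// -s1; apply: ler_sum => i _.
rewrite (le_trans (ler_norm_sum _ _ _))// -[leRHS]mulr1 -t1 mulr_sumr.
apply: ler_sum => j _; rewrite !normrM (ger0_norm (s0 i)) (ger0_norm (t0 j)).
by rewrite ler_piMr ?mulr_ge0// ler_norml.
Qed.

Lemma mixed_payoff_suml (I : finType) g (p : I -> R)
    (S : I -> nat -> A -> R) t x :
  mixed_payoff g (fun n a => \sum_i p i * S i n a) t x =
  \sum_i p i * mixed_payoff g (S i) t x.
Proof.
under [RHS]eq_bigr do rewrite mulr_sumr.
rewrite exchange_big; apply: eq_bigr => i _ /=.
under [RHS]eq_bigr do rewrite mulr_sumr.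
rewrite exchange_big; apply: eq_bigr => j _ /=.
by rewrite !mulr_suml; apply: eq_bigr => l _; rewrite !mulrA.
Qed.

Lemma mixed_payoff_sumr (I : finType) g (p : I -> R) s
    (S : I -> nat -> B -> R) x :
  mixed_payoff g s (fun n b => \sum_i p i * S i n b) x =
  \sum_i p i * mixed_payoff g s (S i) x.
Proof.
under [RHS]eq_bigr do rewrite mulr_sumr.
rewrite exchange_big; apply: eq_bigr => i _ /=.
under [RHS]eq_bigr do rewrite mulr_sumr.
rewrite exchange_big; apply: eq_bigr => j _ /=.
rewrite mulr_sumr !mulr_suml; apply: eq_bigr => l _; ring.
Qed.

Lemma mixed_payoff_sumg (I : finType) (p : I -> R)
    (G : I -> K -> A -> B -> R) s t x :
  mixed_payoff (fun k a b => \sum_i p i * G i k a b) s t x =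
  \sum_i p i * mixed_payoff (G i) s t x.
Proof.
under [RHS]eq_bigr do rewrite mulr_sumr.
rewrite exchange_big; apply: eq_bigr => i _ /=.
under [RHS]eq_bigr do rewrite mulr_sumr.
rewrite exchange_big; apply: eq_bigr => j _ /=.
by rewrite mulr_sumr; apply: eq_bigr => l _; ring.
Qed.

End MixedPayoff.

Section Strategies.
Context {R : realType}.

Definition pure (A : finType) (a : nat -> A) (n : nat) (b : A) : R :=
  (a n == b)%:R.

Lemma sum_pure (A : finType) (a : nat -> A) n (F : A -> R) :
  \sum_b pure a n b * F b = F (a n).
Proof.
rewrite (bigD1 (a n))//= /pure eqxx mul1r big1 ?addr0// => b.
by rewrite eq_sym => /negbTE ->; rewrite mul0r.
Qed.

Lemma pure_strategy (A : finType) (a : nat -> A) : strategies R A (pure a).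
Proof.
move=> n; split; first by move=> b; rewrite /pure.
by rewrite -[RHS](sum_pure a n (fun=> 1)); apply: eq_bigr => b _; rewrite mulr1.
Qed.

(** The weights p may depend on the signal, so this covers both convex
    combinations of strategies and the composition of a strategy with a
    garbling. *)
Lemma mix_strategy (A I : finType) (p : nat -> I -> R)
    (S : I -> nat -> A -> R) :
  strategies R I p -> (forall i, strategies R A (S i)) ->
  strategies R A (fun n a => \sum_i p n i * S i n a).
Proof.
move=> hp hS n; have [p0 p1] := hp n; split.
  by move=> a; apply: sumr_ge0 => i _; rewrite mulr_ge0//; case: (hS i n).
rewrite exchange_big /= -p1; apply: eq_bigr => i _.
by rewrite -mulr_sumr; case: (hS i n) => _ ->; rewrite mulr1.
Qed.

Definition coin (r : R) (b : bool) : R := if b then r else 1 - r.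

Lemma coin_strategy r : 0 <= r <= 1 -> strategies R bool (fun=> coin r).
Proof.
move=> /andP[r0 r1] _; split; first by case=> //=; rewrite subr_ge0.
by rewrite big_bool /= addrC subrK.
Qed.

(** Drawing the actions at the n + 1 signals independently, according to s,
    gives a mixture of pure strategies that plays s: at each signal the marginal
    of the product law is the mixed action of s. Signals above n are read as 0,
    the default value of inord. *)
Lemma strategy_sum_pure (A : finType) n (s : nat -> A -> R) :
  strategies R A s ->
  exists p : {ffun 'I_n.+1 -> A} -> R, [/\ forall phi, 0 <= p phi,
    \sum_phi p phi = 1 &
    forall c a, s (inord c : 'I_n.+1) a =
                \sum_phi p phi * pure (fun c => phi (inord c)) c a].
Proof.
move=> hs; pose p (phi : {ffun 'I_n.+1 -> A}) := \prod_(i < n.+1) s i (phi i).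
have s1 (i : 'I_n.+1) : \sum_a s i a = 1 by case: (hs i).
exists p; split.
- by move=> phi; apply: prodr_ge0 => i _; case: (hs i) => + _; exact.
- by rewrite /p -(bigA_distr_bigA (fun (i : 'I_n.+1) a => s i a)) big1.
move=> c a; pose c0 : 'I_n.+1 := inord c.
pose F (i : 'I_n.+1) b := s i b * (if i == c0 then (b == a)%:R else 1).
transitivity (\sum_(phi : {ffun 'I_n.+1 -> A}) \prod_i F i (phi i)); last first.
  apply: eq_bigr => phi _; rewrite big_split; congr (_ * _) => /=.
  rewrite (bigD1 c0)//= eqxx big1 ?mulr1// => i /negbTE -> //.
rewrite -(bigA_distr_bigA F) (bigD1 c0)//= [X in _ * X]big1 ?mulr1.
  rewrite (bigD1 a)//= /F !eqxx mulr1 big1 ?addr0// => b /negbTE ->.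
  by rewrite mulr0.
move=> i /negbTE ic; rewrite -[RHS](s1 i); apply: eq_bigr => b _.
by rewrite /F ic mulr1.
Qed.

End Strategies.

Section PureMixedPayoff.
Context {R : realType} {K A B : finType} (g : K -> A -> B -> R).

Lemma mixed_payoff_pure1 (a : nat -> A) t x :
  mixed_payoff g (pure a) t x = \sum_j t x.2 j * g x.1.1 (a x.1.2) j.
Proof.
rewrite -(sum_pure a x.1.2 (fun i => \sum_j t x.2 j * g x.1.1 i j)).
apply: eq_bigr => i _; rewrite mulr_sumr.
by apply: eq_bigr => j _; rewrite mulrA.
Qed.

Lemma mixed_payoff_pure2 s (b : nat -> B) x :
  mixed_payoff g s (pure b) x = \sum_i s x.1.2 i * g x.1.1 i (b x.2).
Proof.
apply: eq_bigr => i _; rewrite -(sum_pure b x.2 (fun j => g x.1.1 i j)).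
by rewrite mulr_sumr; apply: eq_bigr => j _; rewrite mulrA.
Qed.

End PureMixedPayoff.

(** * Existence of the value *)

Section Value.
Context {R : realType} {K : finType}.
Variables (u : info_structure R K) (g : payoff_function R K).
Implicit Types (s : nat -> act1 g -> R) (t : nat -> act2 g -> R).

Local Notation S1 := (strategies R (act1 g)).
Local Notation S2 := (strategies R (act2 g)).

Lemma expected_payoffE s t :
  expected_payoff u g s t = expect u (mixed_payoff g s t).
Proof. by []. Qed.

Lemma payoff_bounded1 s t : S1 s -> S2 t -> bounded_by 1 (mixed_payoff g s t).
Proof. exact/mixed_payoff_bounded/payoff_bounded. Qed.

Lemma expected_payoff_bounded s t :
  S1 s -> S2 t -> `|expected_payoff u g s t| <= 1.
Proof.
by move=> hs ht; apply: expect_bounded (ler01) (payoff_bounded1 hs ht).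
Qed.

Lemma expected_payoff_suml (I : finType) (p : I -> R)
    (S : I -> nat -> act1 g -> R) t :
  (forall i, S1 (S i)) -> S2 t ->
  expected_payoff u g (fun n a => \sum_i p i * S i n a) t =
  \sum_i p i * expected_payoff u g (S i) t.
Proof.
move=> hS ht; rewrite -(expect_sum u (M := 1) _ p); last first.
  by move=> i; exact: payoff_bounded1.
by apply: eq_expect => x; exact: mixed_payoff_suml.
Qed.

Lemma expected_payoff_sumr (I : finType) (p : I -> R) s
    (S : I -> nat -> act2 g -> R) :
  S1 s -> (forall i, S2 (S i)) ->
  expected_payoff u g s (fun n b => \sum_i p i * S i n b) =
  \sum_i p i * expected_payoff u g s (S i).
Proof.
move=> hs hS; rewrite -(expect_sum u (M := 1) _ p); last first.
  by move=> i; exact: payoff_bounded1.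
by apply: eq_expect => x; exact: mixed_payoff_sumr.
Qed.

Let s0 : {s | S1 s}.
Proof.
have /card_gt0P/cid[a _] := act1_nonempty g.
by exists (pure (fun=> a)); exact: pure_strategy.
Qed.

Let t0 : {t | S2 t}.
Proof.
have /card_gt0P/cid[b _] := act2_nonempty g.
by exists (pure (fun=> b)); exact: pure_strategy.
Qed.

Let payoffs_against1 s := [set expected_payoff u g s t | t in S2].
Let payoffs_against2 t := [set expected_payoff u g s t | s in S1].

Let has_inf_against1 s : S1 s -> has_inf (payoffs_against1 s).
Proof.
move=> hs; split.
  by exists (expected_payoff u g s (sval t0)), (sval t0); [exact: svalP|].
exists (-1) => _ [t ht <-]; have := expected_payoff_bounded hs ht.
by rewrite ler_norml => /andP[].
Qed.

Let has_sup_against2 t : S2 t -> has_sup (payoffs_against2 t).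
Proof.
move=> ht; split.
  by exists (expected_payoff u g (sval s0) t), (sval s0); [exact: svalP|].
exists 1 => _ [s hs <-]; have := expected_payoff_bounded hs ht.
by rewrite ler_norml => /andP[].
Qed.

Let has_sup_maxmin : has_sup [set inf (payoffs_against1 s) | s in S1].
Proof.
split.
  by exists (inf (payoffs_against1 (sval s0))), (sval s0); [exact: svalP|].
exists 1 => _ [s hs <-].
apply: (@le_trans _ _ (expected_payoff u g s (sval t0))).
  apply: ge_inf; first by case: (has_inf_against1 hs).
  by exists (sval t0) => //; exact: svalP.
have := expected_payoff_bounded hs (svalP t0).
by rewrite ler_norml => /andP[].
Qed.

Let has_inf_minmax : has_inf [set sup (payoffs_against2 t) | t in S2].
Proof.
split.
  by exists (sup (payoffs_against2 (sval t0))), (sval t0); [exact: svalP|].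
exists (-1) => _ [t ht <-].
apply: (@le_trans _ _ (expected_payoff u g (sval s0) t)).
  have := expected_payoff_bounded (svalP s0) ht.
  by rewrite ler_norml => /andP[].
apply: ub_le_sup; first by case: (has_sup_against2 ht).
by exists (sval s0) => //; exact: svalP.
Qed.

Let maxmin_guarantee e : 0 < e ->
  exists2 s, S1 s & forall t, S2 t -> maxmin u g - e <= expected_payoff u g s t.
Proof.
move=> e0; have [_ [s hs <-] lts] := sup_adherent e0 has_sup_maxmin.
exists s => // t ht; apply: (le_trans (ltW lts)); apply: ge_inf.
  by case: (has_inf_against1 hs).
by exists t.
Qed.

Let maxmin_response s e : 0 < e -> S1 s ->
  exists2 t, S2 t & expected_payoff u g s t <= maxmin u g + e.
Proof.
move=> e0 hs; have [_ [t ht <-] ltt] := inf_adherent e0 (has_inf_against1 hs).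
exists t => //; apply: (le_trans (ltW ltt)); rewrite lerD2r.
by apply: ub_le_sup; [case: has_sup_maxmin | exists s].
Qed.

(* The losses of player 2 are the payoffs of the finitely many pure strategies
   of player 1 that depend only on the truncated signal. Responding to a
   mixture, approachability and truncation cost e / 3 each. *)
Let maxmin_defence e : 0 < e ->
  exists2 t, S2 t & forall s, S1 s -> expected_payoff u g s t <= maxmin u g + e.
Proof.
move=> e0; have e30 : 0 < e / 3 by rewrite divr_gt0.
set w := maxmin u g.
have [n trunc] := expect_truncate u e30.
pose S (phi : {ffun 'I_n.+1 -> act1 g}) : nat -> act1 g -> R :=
  pure (fun c => phi (inord c)).
have hS phi : S1 (S phi) by exact: pure_strategy.
pose f phi (t : {t | S2 t}) :=
  expected_payoff u g (S phi) (sval t) - (w + e / 3).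
have [||p p0 p1|t ft] :=
    @approachable R _ _ f (1 + `|w + e / 3|) t0 _ _ _ _ e30.
- move=> phi t; rewrite (le_trans (ler_normB _ _))// lerD2r.
  by apply: expected_payoff_bounded => //; exact: svalP.
- move=> r y z r01.
  pose S' b := if b then sval z else sval y.
  have hS' b : S2 (S' b) by case: b; exact: svalP.
  have hT := mix_strategy (coin_strategy r01) hS'.
  exists (exist _ _ hT) => phi.
  rewrite /f /= expected_payoff_sumr// big_bool /=.
  by rewrite le_eqVlt; apply/orP; left; apply/eqP; rewrite /S' /=; ring.
- have [t ht le_t] := maxmin_response e30 (mix_strategy (fun=> conj p0 p1) hS).
  exists (exist _ t ht); rewrite /f.
  under eq_bigr do rewrite mulrBr.
  rewrite sumrB -mulr_suml p1 mul1r subr_le0 /=.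
  by rewrite expected_payoff_suml in le_t.
have ht := svalP t; exists (sval t) => // s hs.
have [p [p0 p1 ps]] := strategy_sum_pure n hs.
pose s' c := s (inord c : 'I_n.+1).
have hs' : S1 s' by move=> c; exact: hs.
apply: (@le_trans _ _ (expected_payoff u g s' (sval t) + e / 3)).
  apply: trunc; try exact: payoff_bounded1.
  by move=> x xn _; rewrite /mixed_payoff /s' inordK// leqW.
have -> : s' = (fun c a => \sum_phi p phi * S phi c a).
  by apply/funext => c; apply/funext => a; rewrite /s' ps.
have -> : w + e = w + e / 3 + e / 3 + e / 3 by field.
rewrite lerD2r expected_payoff_suml//.
rewrite -[leRHS]mul1r -[X in X * _]p1 mulr_suml; apply: ler_sum => phi _.
by rewrite ler_wpM2l// -lerBlDl; exact: ft.
Qed.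

Let value_maxmin : value u g = maxmin u g.
Proof.
have minmaxE : minmax u g = maxmin u g.
  apply/eqP; rewrite eq_le; apply/andP; split.
  - apply/ler_addgt0Pr => e e0; have [t ht le_t] := maxmin_defence e0.
    apply: (@le_trans _ _ (sup (payoffs_against2 t))).
      by apply: ge_inf; [case: has_inf_minmax | exists t].
    apply: ge_sup; first by case: (has_sup_against2 ht).
    by move=> _ [s hs <-]; exact: le_t.
  - apply: lb_le_inf; first by case: has_inf_minmax.
    move=> _ [t ht <-]; apply: ge_sup; first by case: has_sup_maxmin.
    move=> _ [s hs <-]; apply: (@le_trans _ _ (expected_payoff u g s t)).
      by apply: ge_inf; [case: (has_inf_against1 hs) | exists t].
    by apply: ub_le_sup; [case: (has_sup_against2 ht) | exists s].
rewrite /value; case: xgetP => [w -> [<-]//|/(_ (maxmin u g))[]].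
by split.
Qed.

(** Optimal strategies up to e, for both players: together they characterise the
    value, and the rest of the development uses nothing else about it. *)
Lemma guarantee_value1 e : 0 < e ->
  exists2 s, S1 s & forall t, S2 t -> value u g - e <= expected_payoff u g s t.
Proof. by rewrite value_maxmin; exact: maxmin_guarantee. Qed.

Lemma guarantee_value2 e : 0 < e ->
  exists2 t, S2 t & forall s, S1 s -> expected_payoff u g s t <= value u g + e.
Proof. by rewrite value_maxmin; exact: maxmin_defence. Qed.

Lemma value_ge c s : S1 s -> (forall t, S2 t -> c <= expected_payoff u g s t) ->
  c <= value u g.
Proof.
move=> hs le_c; apply/ler_addgt0Pr => e e0.
have [t ht le_t] := guarantee_value2 e0.
exact: le_trans (le_c t ht) (le_t s hs).
Qed.

Lemma value_le c t : S2 t -> (forall s, S1 s -> expected_payoff u g s t <= c) ->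
  value u g <= c.
Proof.
move=> ht ge_c; apply/ler_addgt0Pr => e e0.
have [s hs ge_s] := guarantee_value1 e0.
by rewrite -lerBlDr; exact: le_trans (ge_s t ht) (ge_c s hs).
Qed.

End Value.

(** * Comparison of information structures *)

Section Comparison.
Context {R : realType} {K : finType}.
Implicit Types (u v : info_structure R K) (g : payoff_function R K).

Lemma tv_distC u v : tv_dist u v = tv_dist v u.
Proof. by congr fine; apply: eq_esum => x _; rewrite distrC. Qed.

(** A strategy of player 1 that is e-optimal in u loses at most the distance
    when it is played in v. *)
Lemma value_tv_dist u v g : value u g - value v g <= tv_dist u v.
Proof.
rewrite lerBlDl -lerBlDr; apply/ler_addgt0Pr => e e0.
have [s hs ge_s] := guarantee_value1 u g e0.
rewrite -lerBlDr; apply: (value_ge hs) => t ht.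
have : expected_payoff u g s t - expected_payoff v g s t <= tv_dist u v.
  exact/expect_tv_dist/payoff_bounded1.
have := ge_s t ht.
move: (value u g) (expected_payoff u g s t) (expected_payoff v g s t).
by move: (tv_dist u v) => ? ? ? ? ? ?; lra.
Qed.

Section Garbling.
Variables (n : nat) (q : nat -> 'I_n -> R).
Hypothesis hq : strategies R 'I_n q.

Definition garble1 u : info_structure R K :=
  @push R K 'I_n u (fun x => q x.1.2) (fun x b => (x.1.1, val b, x.2))
    (fun x => (hq x.1.2).1) (fun x => (hq x.1.2).2).

Definition garble2 u : info_structure R K :=
  @push R K 'I_n u (fun x => q x.2) (fun x b => (x.1.1, x.1.2, val b))
    (fun x => (hq x.2).1) (fun x => (hq x.2).2).

Lemma expected_payoff_garble1 u g s t :
  strategies R (act1 g) s -> strategies R (act2 g) t ->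
  expected_payoff (garble1 u) g s t =
  expected_payoff u g (fun c a => \sum_b q c b * s (val b) a) t.
Proof.
move=> hs ht.
rewrite expected_payoffE (expect_push _ _ _ _ (payoff_bounded1 hs ht)).
apply: eq_expect => x.
exact/esym/(mixed_payoff_suml g (q x.1.2) (fun b _ => s (val b)) t x).
Qed.

Lemma expected_payoff_garble2 u g s t :
  strategies R (act1 g) s -> strategies R (act2 g) t ->
  expected_payoff (garble2 u) g s t =
  expected_payoff u g s (fun d a => \sum_b q d b * t (val b) a).
Proof.
move=> hs ht.
rewrite expected_payoffE (expect_push _ _ _ _ (payoff_bounded1 hs ht)).
apply: eq_expect => x.
exact/esym/(mixed_payoff_sumr g (q x.2) s (fun b _ => t (val b)) x).
Qed.

(** Player 1 can garble her own signal: whatever she guarantees with the garbled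
    signal, she guarantees with the original one. *)
Lemma prefers_garble1 u : prefers u (garble1 u).
Proof.
move=> g; apply/ler_addgt0Pr => e e0.
have [s hs ge_s] := guarantee_value1 (garble1 u) g e0.
have hqs : strategies R (act1 g) (fun c a => \sum_b q c b * s (val b) a).
  by apply: (@mix_strategy _ _ _ q (fun b _ => s (val b))) => // b c; exact: hs.
rewrite -lerBlDr; apply: (value_ge hqs) => t ht.
by rewrite -expected_payoff_garble1//; exact: ge_s.
Qed.

Lemma prefers_garble2 u : prefers (garble2 u) u.
Proof.
move=> g; apply/ler_addgt0Pr => e e0.
have [t ht le_t] := guarantee_value2 (garble2 u) g e0.
have hqt : strategies R (act2 g) (fun d a => \sum_b q d b * t (val b) a).
  by apply: (@mix_strategy _ _ _ q (fun b _ => t (val b))) => // b d; exact: ht.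
apply: (value_le hqt) => s hs.
by rewrite -expected_payoff_garble2//; exact: le_t.
Qed.

End Garbling.

Definition sign (b : bool) : R := if b then 1 else -1.

Lemma sign_bounded b : -1 <= sign b <= 1.
Proof. by case: b => /=; apply/andP; split; lra. Qed.

Lemma mean_sign_bounded (I : finType) (p : I -> R) (b : I -> bool) :
  (forall i, 0 <= p i) -> \sum_i p i = 1 -> -1 <= \sum_i p i * sign (b i) <= 1.
Proof.
move=> p0 p1; rewrite -ler_norml (le_trans (ler_norm_sum _ _ _))//.
rewrite -[leRHS]p1; apply: ler_sum => i _.
rewrite normrM ger0_norm// ler_piMr// ler_norml; exact: sign_bounded.
Qed.

(** The losses are indexed by the sign functions phi on the truncated triples,
    and the choice variable is a pair of garblings, s of the signal of player 1
    in u and t of the signal of player 2 in v. The e / 5 errors are two for the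
    near-optimal responses s and t to a mixture of sign functions, one for the
    approachability and two for the truncation of u and v. *)
Lemma exists_close_garblings u v (W e : R) : 0 < e ->
  (forall g, value v g - value u g <= W) ->
  exists u' v', [/\ prefers u u', prefers v' v & tv_dist u' v' <= W + e].
Proof.
move=> e0 leW; pose d := e / 5; have d0 : 0 < d by rewrite divr_gt0.
have [nu trunc_u] := expect_truncate u d0.
have [nv trunc_v] := expect_truncate v d0.
pose n := maxn nu nv.
(* The truthful announcement, up to the truncation of the signal. *)
pose id_sig : nat -> 'I_n.+1 -> R := pure inord.
have hid : strategies R 'I_n.+1 id_sig by exact: pure_strategy.
pose G (phi : {ffun K * 'I_n.+1 * 'I_n.+1 -> bool}) k i j : R :=
  sign (phi (k, i, j)).
have G1 phi k i j : -1 <= G phi k i j <= 1 by exact: sign_bounded.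
pose Y := ({q : nat -> 'I_n.+1 -> R | strategies R 'I_n.+1 q} *
           {q : nat -> 'I_n.+1 -> R | strategies R 'I_n.+1 q})%type.
pose f phi (y : Y) :=
  expect v (mixed_payoff (G phi) id_sig (sval y.2))
  - expect u (mixed_payoff (G phi) (sval y.1) id_sig) - (W + 2 * d).
have payoffB (s t : nat -> 'I_n.+1 -> R) phi :
    strategies R 'I_n.+1 s -> strategies R 'I_n.+1 t ->
    bounded_by 1 (mixed_payoff (G phi) s t).
  by move=> hs ht; exact: mixed_payoff_bounded.
have [||p p0 p1|y fy] := @approachable R _ _ f (1 + 1 + `|W + 2 * d|)
    (exist _ _ hid, exist _ _ hid) _ _ _ _ d0.
- move=> phi [[s hs] [t ht]]; rewrite (le_trans (ler_normB _ _))// lerD2r.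
  rewrite (le_trans (ler_normB _ _))// lerD//;
    exact: expect_bounded (ler01) (payoffB _ _ _ _ _).
- move=> r [[s hs] [t ht]] [[s' hs'] [t' ht']] r01.
  pose S b := if b then s' else s.
  pose T b := if b then t' else t.
  have hS b : strategies R 'I_n.+1 (S b) by case: b.
  have hT b : strategies R 'I_n.+1 (T b) by case: b.
  have hS' := mix_strategy (coin_strategy r01) hS.
  have hT' := mix_strategy (coin_strategy r01) hT.
  exists (exist _ _ hS', exist _ _ hT') => phi; rewrite /f /=.
  rewrite (eq_expect _ (mixed_payoff_suml _ _ _ _)).
  rewrite (eq_expect _ (mixed_payoff_sumr _ _ _ _)).
  rewrite !(@expect_sum _ _ _ 1); try by move=> b; exact: payoffB.
  by rewrite !big_bool /= le_eqVlt; apply/orP; left; apply/eqP; ring.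
- have c1 : (0 < #|'I_n.+1|)%N by rewrite card_ord.
  pose g := @PayoffFunction R K _ _
    (fun k i j => \sum_phi p phi * G phi k i j) c1 c1
    (fun k i j =>
       mean_sign_bounded (fun phi : {ffun _ -> _} => phi (k, i, j)) p0 p1).
  have [t ht le_t] := guarantee_value2 v g d0.
  have [s hs ge_s] := guarantee_value1 u g d0.
  exists (exist _ s hs, exist _ t ht); rewrite /f /=.
  have mean (w : info_structure R K) s' t' :
      strategies R 'I_n.+1 s' -> strategies R 'I_n.+1 t' ->
      \sum_phi p phi * expect w (mixed_payoff (G phi) s' t') =
      expected_payoff w g s' t'.
    move=> hs' ht'; have S1 phi := payoffB _ _ phi hs' ht'.
    rewrite -(expect_sum w _ p S1).
    exact/esym/eq_expect/(mixed_payoff_sumg p G s' t').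
  under eq_bigr do rewrite 2!mulrBr.
  rewrite 2!sumrB -mulr_suml p1 mul1r subr_le0 !mean//.
  have := leW g; have := le_t _ hid; have := ge_s _ hid.
  move: (value u g) (value v g) (expected_payoff u _ _ _).
  by move: (expected_payoff v _ _ _) => ? ? ? ? ? ? ?; lra.
case: y fy => -[s hs] [t ht]; rewrite /f /= => fy.
pose u' := garble1 hs u; pose v' := garble2 ht v.
exists u', v'; split; [exact: prefers_garble1|exact: prefers_garble2|].
pose sg := sign_diff v' u'.
have sg1 : bounded_by 1 sg.
  by move=> x; rewrite /sg /sign_diff; case: ifP => _; rewrite ?normrN normr1.
(* phi restricts the sign of v' - u' to the truncated triples. *)
pose phi := [ffun z : K * 'I_n.+1 * 'I_n.+1 =>
   u' (z.1.1, val z.1.2, val z.2) <= v' (z.1.1, val z.1.2, val z.2)].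
have Gphi k i j : G phi k i j = sg (k, val i, val j) by rewrite /G ffunE.
have near_v : expect v' sg <= expect v (mixed_payoff (G phi) id_sig t) + d.
  rewrite /v' (@expect_push _ _ _ _ _ _ _ _ 1)//; apply: trunc_v.
  - by apply: weighted_sum_bounded => [x b|x|x b];
      [case: (ht x.2)|case: (ht x.2)|].
  - exact: payoffB.
  - move=> x xn _; rewrite mixed_payoff_pure1; apply: eq_bigr => j _.
    by rewrite Gphi /= inordK// ltnW// ltnS (leq_trans xn)// leq_maxr.
have near_u : expect u (mixed_payoff (G phi) s id_sig) <= expect u' sg + d.
  rewrite /u' (@expect_push _ _ _ _ _ _ _ _ 1)//; apply: trunc_u.
  - exact: payoffB.
  - by apply: weighted_sum_bounded => [x b|x|x b];
      [case: (hs x.1.2)|case: (hs x.1.2)|].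
  - move=> x _ xn; rewrite mixed_payoff_pure2; apply: eq_bigr => j _.
    by rewrite Gphi /= inordK// ltnW// ltnS (leq_trans xn)// leq_maxl.
rewrite tv_distC tv_dist_sign -/sg.
have := fy phi; have -> : e = 5 * d by rewrite /d; field.
move: (expect v' sg) (expect u' sg) (expect u _) (expect v _) near_u near_v.
by move=> ? ? ? ? ? ? ?; lra.
Qed.

End Comparison.

Theorem corollary3 (R : realType) (K : finType) (hK : (1 < #|K|)%N)
    (u v : info_structure R K) :
  sup [set r : R | exists g : payoff_function R K, r = value v g - value u g]
  = inf [set r : R | exists u' v' : info_structure R K,
      [/\ prefers u u', prefers v' v & r = tv_dist u' v']].
Proof.
set gaps := (X in sup X); set dists := (X in inf X).
have le_gap_dist r r' : gaps r -> dists r' -> r <= r'.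
  move=> [g ->] [u' [v' [uu' v'v ->]]].
  have := value_tv_dist v' u' g; rewrite tv_distC; apply: le_trans.
  by apply: lerB; [exact: v'v|exact: uu'].
have dist_uv : dists (tv_dist u v).
  by exists u, v; split=> [g|g|]; rewrite ?lexx.
have [r0 gap_r0] : gaps !=set0.
  have unit1 : (0 < #|{: unit}|)%N by rewrite card_unit.
  have zero1 (k : K) (i j : unit) : -1 <= (0 : R) <= 1 by rewrite lerN10 ler01.
  by eexists; exists (PayoffFunction unit1 unit1 zero1).
have sup_gaps : has_sup gaps.
  by split; [exists r0|exists (tv_dist u v) => r /le_gap_dist; exact].
have inf_dists : has_inf dists.
  by split; [exists (tv_dist u v)|exists r0 => r; exact: le_gap_dist].
apply/eqP; rewrite eq_le; apply/andP; split.
  apply: ge_sup; first by case: sup_gaps.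
  move=> r gr; apply: lb_le_inf; first by case: inf_dists.
  by move=> r'; exact: le_gap_dist.
apply/ler_addgt0Pr => e e0.
have [g|u' [v' [uu' v'v le_e]]] :=
    @exists_close_garblings R K u v (sup gaps) e e0.
  by apply: ub_le_sup; [case: sup_gaps|exists g].
by apply: le_trans le_e; apply: ge_inf; [case: inf_dists|exists u', v'].
Qed.
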